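(* Let $(\mathbb{V},\mathbb{W},\lambda)$ be a finite-dimensional FTvN system with $\mathcal{K}:=\lambda(\mathbb{V})$, and let $\mathcal{C}\subseteq\mathbb{W}$ be feasible, i.e. $\mathcal{C}\cap\mathcal{K}\neq\emptyset$. Then $$\mathsf{conv}\,\lambda^{-1}(\mathcal{C}) = \lambda^{-1}\big(\mathsf{conv}(\mathcal{C}\cap\mathcal{K})+\mathcal{K}^\circ\big) = \{x\in\mathbb{V} : \exists\, u\in\mathsf{conv}(\mathcal{C}\cap\mathcal{K}) \text{ such that } \lambda(x)-u\in\mathcal{K}^\circ\}.$$ Also, for any convex set $\mathcal{D}$ such that $\mathsf{conv}(\mathcal{C}\cap\mathcal{K})\subseteq\mathcal{D}\subseteq\mathsf{clconv}(\mathcal{C}\cap\mathcal{K})$, we have $$\mathsf{clconv}\,\lambda^{-1}(\mathcal{C}) = \mathsf{cl}\,\lambda^{-1}(\mathcal{D}+\mathcal{K}^\circ).$$ In particular, if $\mathcal{D}+\mathcal{K}^\circ$ is closed, then $\mathsf{clconv}\,\lambda^{-1}(\mathcal{C}) = \lambda^{-1}(\mathcal{D}+\mathcal{K}^\circ)$.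
   Context: Let $\mathbb{V},\mathbb{W}$ be finite-dimensional real inner-product spaces and $\lambda:\mathbb{V}\to\mathbb{W}$ a (generally nonlinear) map. $(\mathbb{V},\mathbb{W},\lambda)$ is called an FTvN system if: (P1) $\langle x,y\rangle\le\langle\lambda(x),\lambda(y)\rangle$ for all $x,y\in\mathbb{V}$; and (P2) for all $c\in\mathbb{V}$ and $u\in\lambda(\mathbb{V})$ there exists $x\in\mathbb{V}$ such that $\lambda(x)=u$ and $\langle c,x\rangle=\langle\lambda(c),\lambda(x)\rangle$. In this case the range $\mathcal{K}:=\lambda(\mathbb{V})\subseteq\mathbb{W}$ is known to be a nonempty closed convex cone. Its polar cone is $\mathcal{K}^\circ:=\{y\in\mathbb{W}:\langle y,x\rangle\le 0\ \forall x\in\mathcal{K}\}$. For a set $\mathcal{A}\subseteq\mathbb{W}$, $\lambda^{-1}(\mathcal{A}):=\{x\in\mathbb{V}:\lambda(x)\in\mathcal{A}\}$ is the preimage. $\mathsf{conv}$, $\mathsf{cl}$ and $\mathsf{clconv}$ denote convex hull, closure and closed convex hull; sums of sets are Minkowski sums. *)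

(* Defs.v *)
From HB Require Import structures.
From mathcomp Require Import all_boot all_order all_algebra.
From mathcomp Require Import all_classical all_reals topology normedtype convex.
From mathcomp Require Import ring lra.

Set Implicit Arguments.
Unset Strict Implicit.
Unset Printing Implicit Defensive.

Import Order.TTheory GRing.Theory Num.Theory.
Import numFieldNormedType.Exports.

Local Open Scope classical_set_scope.
Local Open Scope ring_scope.

(* Finite-dimensional real inner-product spaces.  The norm, hence the topology
   used by [closed] and [closure], is the one induced by [inner]. *)
HB.mixin Record NormedVector_isEuclidean (R : realType) V
    of NormedModule R V & Vector R V := {
  inner : {dot V for (@idfun R)} ;
  norm_inner : forall x : V, `|x| = Num.sqrt (inner x x)
}.

#[short(type="euclideanType")]
HB.structure Definition Euclidean (R : realType) :=
  {V of NormedModule R V & Vector R V & NormedVector_isEuclidean R V}.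

(* Any inner product on any finite-dimensional real vector space gives rise to
   a Euclidean space, with the norm it induces. *)
HB.factory Record Vector_isEuclidean (R : realType) V of Vector R V := {
  dotf : {dot V for (@idfun R)}
}.

HB.builders Context R V of Vector_isEuclidean R V.

Let norm (x : V) : R := Num.sqrt (dotf x x).

Let inner_ge0 (x : V) : 0 <= dotf x x.
Proof.
have [->|x0] := eqVneq x 0; first by rewrite linear0l.
exact/ltW/neq0_dnorm_gt0.
Qed.

Let innerC (x y : V) : dotf x y = dotf y x.
Proof. by have /= := hermC dotf x y; rewrite expr0 mul1r. Qed.

Let CS (x y : V) : dotf x y <= norm x * norm y.
Proof.
have [->|y0] := eqVneq y 0.
  by rewrite linear0r mulr_ge0 ?sqrtr_ge0.
have yy : 0 < dotf y y by exact: neq0_dnorm_gt0.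
rewrite /norm -sqrtrM//; apply: le_trans (ler_norm _) _.
rewrite -sqrtr_sqr ler_sqrt ?mulr_ge0//.
set a := dotf y y; set b := dotf x y.
have := inner_ge0 (a *: x - b *: y).
rewrite linearBl !linearBr !linearZl_LR !linearZr_LR /= -/a -/b [dotf y x]innerC -/b -/a.
rewrite (_ : _ - _ = a * (dotf x x * a - b ^+ 2)); last by ring.
by rewrite pmulr_rge0// subr_ge0.
Qed.

Let norm_triangle (x y : V) : norm (x + y) <= norm x + norm y.
Proof.
rewrite -(ler_pXn2r (n := 2))// ?nnegrE ?addr_ge0 ?sqrtr_ge0//.
rewrite sqrrD /norm !sqr_sqrtr// -/(norm x) -/(norm y).
rewrite linearDl !linearDr /= [dotf y x]innerC.
have := CS x y; lra.
Qed.

Let norm_scale (l : R) (x : V) : norm (l *: x) = `|l| * norm x.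
Proof.
by rewrite /norm linearZl_LR linearZr_LR /= mulrA -expr2 sqrtrM ?sqr_ge0// sqrtr_sqr.
Qed.

Let norm_eq0 (x : V) : norm x = 0 -> x = 0.
Proof.
move=> x0; apply/eqP; apply: contraT => /(@neq0_dnorm_gt0 _ _ _ dotf).
by rewrite -sqrtr_gt0 -/(norm x) x0 ltxx.
Qed.

HB.instance Definition _ :=
  @Lmodule_isNormed.Build R V norm norm_triangle norm_scale norm_eq0.
HB.instance Definition _ :=
  @NormedVector_isEuclidean.Build R V dotf (fun=> erefl).

HB.end.

Section FTvN.
Variables (R : realType) (V W : euclideanType R).
Implicit Types (A B : set V) (lambda : V -> W).

Record FTvN lambda : Prop := {
  FTvN_le : forall x y : V, inner x y <= inner (lambda x) (lambda y) ;
  FTvN_attained : forall (c : V) (u : W), range lambda u ->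
    exists2 x : V, lambda x = u & inner c x = inner (lambda c) (lambda x)
}.

Definition convex_hull A : set V := smallest (@convex_set R V) A.

Definition closed_convex_hull A : set V :=
  smallest [set B | convex_set B /\ closed B] A.

Definition minkowski_sum A B : set V := [set x + y | x in A & y in B].

Definition polar_cone A : set V := [set y | forall x, A x -> inner y x <= 0].

End FTvN.

(* Main.v *)
(* For c in V and u in K, the maximum of <c, .> over lambda^-1(u) is
   <lambda(c), u>.  So if lambda(x) = w + k with k in the polar
   of K, then <c, x> <= <lambda(c), lambda(x)> <= <lambda(c), w>, and bounds on
   w by means of C /\ K turn into bounds on x by means of lambda^-1(C).
   If w lies in conv(C /\ K), it is dominated, in every direction, by a compact
   subset B of C /\ K; hence x is dominated by the compact set lambda^-1(B), and
   a point dominated by a compact set lies in its convex hull (Minkowski).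
   If w lies in clconv(C /\ K), separation of points from closed convex sets
   gives x in clconv lambda^-1(C).  The converse inclusions hold because lambda
   is continuous and sublinear modulo the polar of K, so that the preimage of
   D plus the polar is convex whenever D is. *)
Require Import Defs.
From mathcomp Require Import all_boot all_order all_algebra.
From mathcomp Require Import all_classical all_reals topology normedtype convex.
From mathcomp Require Import interval_inference derive.
From mathcomp Require Import ring lra.

Set Implicit Arguments.
Unset Strict Implicit.
Unset Printing Implicit Defensive.

Import Order.TTheory GRing.Theory Num.Theory.
Import numFieldNormedType.Exports.

Local Open Scope classical_set_scope.
Local Open Scope ring_scope.

(** * Inner product identities and Cauchy-Schwarz *)

Section InnerProduct.
Variables (R : realType) (V : euclideanType R).
Implicit Types (x y z d : V) (a t : R).

Lemma innerC x y : inner x y = inner y x.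
Proof. by have /= := hermC (@inner R V) x y; rewrite expr0 mul1r. Qed.

Lemma innerDl x y z : inner (x + y) z = inner x z + inner y z.
Proof. by rewrite linearDl. Qed.

Lemma innerDr x y z : inner x (y + z) = inner x y + inner x z.
Proof. by rewrite linearDr. Qed.

Lemma innerBl x y z : inner (x - y) z = inner x z - inner y z.
Proof. by rewrite linearBl. Qed.

Lemma innerBr x y z : inner x (y - z) = inner x y - inner x z.
Proof. by rewrite linearBr. Qed.

Lemma innerZl a x y : inner (a *: x) y = a * inner x y.
Proof. by rewrite linearZl_LR. Qed.

Lemma innerZr a x y : inner x (a *: y) = a * inner x y.
Proof. by rewrite linearZr_LR. Qed.

Lemma inner0l x : inner 0 x = 0.
Proof. by rewrite linear0l. Qed.

Lemma innerNl x y : inner (- x) y = - inner x y.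
Proof. by rewrite linearNl. Qed.

Lemma innerNr x y : inner x (- y) = - inner x y.
Proof. by rewrite linearNr. Qed.

Definition innerE := (innerDl, innerDr, innerNl, innerNr, innerZl, innerZr).

Lemma inner_ge0 x : 0 <= inner x x.
Proof.
have [->|x0] := eqVneq x 0; first by rewrite inner0l.
exact/ltW/neq0_dnorm_gt0.
Qed.

Lemma inner_norm x : inner x x = `|x| ^+ 2.
Proof. by rewrite norm_inner sqr_sqrtr// inner_ge0. Qed.

Lemma inner_le x y : inner x y <= `|x| * `|y|.
Proof.
have [->|y0] := eqVneq y 0; first by rewrite linear0r normr0 mulr0.
have yy : 0 < `|y| by rewrite normr_gt0.
have [->|x0] := eqVneq x 0; first by rewrite inner0l normr0 mul0r.
have xx : 0 < `|x| by rewrite normr_gt0.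
(* This square equals [2 * |x| * |y| * (|x| * |y| - inner x y)]. *)
have := inner_ge0 (`|y| *: x - `|x| *: y).
rewrite !innerE (innerC y x) !inner_norm.
set b := inner x y => h.
have : 0 <= (`|x| * `|y|) * (`|x| * `|y| - b) by nra.
by rewrite pmulr_rge0 ?mulr_gt0// subr_ge0.
Qed.

Lemma normr_inner_le x y : `|inner x y| <= `|x| * `|y|.
Proof.
rewrite ler_norml inner_le andbT lerNl -mulN1r -innerZl.
by rewrite (le_trans (inner_le _ _))// scaleN1r normrN.
Qed.

End InnerProduct.

(** * Continuity and extrema on compact sets *)

Lemma lipschitz_continuous (R : realType) (V W : normedModType R) (k : R)
    (f : V -> W) :
  (forall x y, `|f x - f y| <= k * `|x - y|) -> continuous f.
Proof.
move=> fk x; apply/cvgrPdist_lt => e e0.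
have k1 : 0 < `|k| + 1 by rewrite ltr_wpDl.
near=> y.
apply: (le_lt_trans (fk _ _)).
have : `|x - y| < e / (`|k| + 1).
  by near: y; apply: cvgr_dist_lt => //; exact: divr_gt0.
rewrite ltr_pdivlMr//; apply: le_lt_trans.
rewrite mulrC ler_wpM2l//; apply: le_trans (ler_norm k) _.
by rewrite lerDl.
Unshelve. all: by end_near. Qed.

Lemma inner_continuous (R : realType) (V : euclideanType R) (c : V) :
  continuous (inner c : V -> R).
Proof.
apply: (@lipschitz_continuous _ _ R^o `|c|) => x y.
by rewrite -innerBr normr_inner_le.
Qed.

Lemma closed_preimage (T U : topologicalType) (f : T -> U) (D : set U) :
  continuous f -> closed D -> closed (f @^-1` D).
Proof. by move=> fc; apply: preimage_closed => x _; exact: fc. Qed.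

Lemma closed_le_preimage (R : realType) (T : topologicalType) (f : T -> R) a :
  continuous f -> closed [set x | f x <= a].
Proof.
move=> fc; apply: (@closed_preimage _ _ f [set r | r <= a]) => //.
Qed.

Lemma compact_max (R : realType) (V : normedModType R) (A : set V) (f : V -> R) :
  compact A -> A !=set0 -> continuous f ->
  exists2 x, A x & forall y, A y -> f y <= f x.
Proof.
move=> cA A0 fc.
have [|x /set_mem Ax xP] := compact_EVT_max A0 cA (f := f).
  exact: continuous_subspaceT.
by exists x => // y Ay; apply: xP; exact: mem_set.
Qed.

Lemma compact_min (R : realType) (V : normedModType R) (A : set V) (f : V -> R) :
  compact A -> A !=set0 -> continuous f ->
  exists2 x, A x & forall y, A y -> f x <= f y.
Proof.
move=> cA A0 fc.
have [|x Ax xP] := compact_max (f := fun x => - f x) cA A0.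
  by move=> x; apply: continuousN; exact: fc.
by exists x => // y /xP; rewrite lerN2.
Qed.

(** * Heine-Borel in Euclidean spaces, through coordinates *)

Section Compactness.
Variables (R : realType) (V : euclideanType R).

Let n := \dim {:V}.
Let f (r : 'rV[R]_n) : V := \sum_i r 0 i *: (vbasis {:V})`_i.

Let f_additive r s : f (r - s) = f r - f s.
Proof. by rewrite /f -sumrB; apply: eq_bigr => i _; rewrite !mxE scalerBl. Qed.

Let f_scale a r : f (a *: r) = a *: f r.
Proof. by rewrite /f scaler_sumr; apply: eq_bigr => i _; rewrite mxE scalerA. Qed.

Let f_continuous : continuous f.
Proof.
apply: (@lipschitz_continuous R 'rV[R]_n V (\sum_(i < n) `|(vbasis {:V})`_i|)) => r s.
rewrite -f_additive /f; apply: (le_trans (ler_norm_sum _ _ _)).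
rewrite mulr_suml ler_sum// => i _.
rewrite normrZ mulrC ler_wpM2l//.
rewrite [leRHS]/Num.norm /= mx_normrE; apply/bigmax_geP; right => /=.
by exists (0, i).
Qed.

Let f_inj r : f r = 0 -> r = 0.
Proof.
move=> fr0; apply/rowP => i; rewrite mxE.
have /freeP/(_ (r 0)) := basis_free (vbasisP {:V}).
exact.
Qed.

Let f_surj x : exists r, f r = x.
Proof.
exists (\row_i coord (vbasis {:V}) i x).
rewrite [RHS](coord_vbasis (memvf x)) /f.
by apply: eq_bigr => i _; rewrite mxE.
Qed.

(** By injectivity [|f r|] has a positive minimum on the unit sphere, and homogeneity extends the
    bound. So [f]-preimages of bounded sets are bounded. *)
Let f_bounded_below : exists2 m : R, 0 < m & forall r, m * `|r| <= `|f r|.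
Proof.
pose S := [set r : 'rV[R]_n | `|r| = 1].
have nf : continuous (fun r => `|f r|).
  by move=> r; apply: continuous_comp; [exact: f_continuous|exact: norm_continuous].
(* The sphere is empty only in dimension 0, where any constant works. *)
have [S0|/set0P S0] := eqVneq S set0.
  exists 1 => // r; have [->|r0] := eqVneq r 0; first by rewrite normr0 mulr0.
  have : S (`|r|^-1 *: r).
    by rewrite /S /= normrZ normfV normr_id mulVf// normr_eq0.
  by rewrite S0.
have cS : compact S.
  apply: bounded_closed_compact.
    by exists 1; split => // M M1 r /= ->; exact: ltW.
  apply: (@closed_preimage _ _ (fun r : 'rV[R]_n => `|r|) [set 1]).
    exact: norm_continuous.
  exact: closed_eq.
have [r0 Sr0 r0P] := compact_min cS S0 nf.
exists `|f r0|.
  rewrite normr_gt0; apply/eqP => /f_inj r00.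
  by move: Sr0; rewrite /S /= r00 normr0 => /esym/eqP; rewrite oner_eq0.
move=> r; have [->|rn0] := eqVneq r 0; first by rewrite normr0 mulr0.
have rn : 0 < `|r| by rewrite normr_gt0.
have /r0P : S (`|r|^-1 *: r).
  by rewrite /S /= normrZ normfV normr_id mulVf// normr_eq0.
by rewrite f_scale normrZ normfV normr_id mulrC ler_pdivlMr.
Qed.

Lemma closed_bounded_compact (A : set V) (M : R) :
  closed A -> (forall x, A x -> `|x| <= M) -> compact A.
Proof.
move=> clA AM.
have -> : A = f @` (f @^-1` A).
  rewrite eqEsubset; split; last by move=> _ [r Ar <-].
  by move=> x Ax; have [r frx] := f_surj x; exists r => //=; rewrite frx.
apply: continuous_compact; first exact: continuous_subspaceT.
apply: bounded_closed_compact; last exact: closed_preimage.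
have [m m0 mP] := f_bounded_below.
exists (M / m); split; first exact: num_real.
move=> N MN r /= /AM frM; apply: ltW; apply: le_lt_trans MN.
by rewrite ler_pdivlMr// mulrC (le_trans (mP r)).
Qed.

End Compactness.

(** * Convex hulls and Minkowski's theorem *)

Lemma convex_setP (R : realType) (V : lmodType R) (A : set V) :
  convex_set A <->
  forall x y (t : R), 0 <= t <= 1 -> A x -> A y -> A (t *: x + (1 - t) *: y).
Proof.
split=> [cA x y t t01 Ax Ay|cA x y t /set_mem Ax /set_mem Ay].
  have := cA x y (Itv01 (andP t01).1 (andP t01).2) (mem_set Ax) (mem_set Ay).
  by move=> /set_mem.
by apply: mem_set; apply: cA => //; rewrite ge0 le1.
Qed.

Section Hulls.
Variables (R : realType) (V : euclideanType R).
Implicit Types (x y d s : V) (S H : set V) (L : {vspace V}).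

Lemma convex_hull_convex (A : set V) : convex_set (convex_hull A).
Proof.
apply/convex_setP => x y t t01 Ax Ay B [cB AB].
by move/convex_setP: (cB); apply => //; [exact: Ax|exact: Ay].
Qed.

Lemma closed_convex_hull_convex (A : set V) : convex_set (closed_convex_hull A).
Proof.
apply/convex_setP => x y t t01 Ax Ay B [[cB clB] AB].
by move/convex_setP: (cB); apply => //; [exact: Ax|exact: Ay].
Qed.

Lemma closed_convex_hull_closed (A : set V) : closed (closed_convex_hull A).
Proof. by apply: closed_bigI => B [[]]. Qed.

(** With one endpoint fixed, a convex combination is Lipschitz in the other, so closedness lets the
    endpoints pass to the closure one at a time. *)
Lemma closure_convex (A : set V) : convex_set A -> convex_set (closure A).
Proof.
move=> /convex_setP cA; apply/convex_setP => x y t t01 Ax Ay.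
have affine_closed (a b : R) z :
    closed ((fun w => a *: w + b *: z) @^-1` closure A).
  apply: closed_preimage; last exact: closed_closure.
  apply: (@lipschitz_continuous _ _ _ `|a|) => w w'.
  by rewrite opprD addrACA subrr addr0 -scalerBr normrZ.
suff Axb b : A b -> closure A (t *: x + (1 - t) *: b).
  have := affine_closed (1 - t) t x; move: Ay; rewrite {1}closureE => Ay cl.
  by rewrite addrC; apply: (Ay _ (conj cl _)) => b /Axb; rewrite addrC.
move=> Ab; move: Ax; rewrite {1}closureE => Ax.
apply: (Ax _ (conj (affine_closed t (1 - t) b) _)) => a Aa.
by apply: subset_closure; exact: cA.
Qed.

Lemma inner_le_convex d a : convex_set [set x : V | inner d x <= a].
Proof. apply/convex_setP => x y t /andP[t0 t1] /= dx dy; rewrite !innerE; nra. Qed.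

(** [h] is the support function of [S]; it is Lipschitz with constant the largest norm in [S]. *)
Lemma support_function S : compact S -> S !=set0 ->
  exists2 h : V -> R, continuous h & forall d,
    (forall s, S s -> inner d s <= h d) /\ exists2 s, S s & h d = inner d s.
Proof.
move=> cS S0.
have /choice[m mP] d : exists s, S s /\ forall s', S s' -> inner d s' <= inner d s.
  have [s Ss sP] := compact_max cS S0 (@inner_continuous _ _ d).
  by exists s.
exists (fun d => inner d (m d)); last first.
  by move=> d; have [Sm mdP] := mP d; split=> //; exists (m d).
have [b Sb bP] := compact_max cS S0 (@norm_continuous _ V).
have half d d' : inner d (m d) - inner d' (m d') <= `|b| * `|d - d'|.
  have [Sm _] := mP d; have [_ /(_ _ Sm)] := mP d'.
  have := inner_le (d - d') (m d); rewrite !innerE.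
  have := ler_wpM2l (normr_ge0 (d - d')) (bP _ Sm).
  lra.
apply: (@lipschitz_continuous _ _ R^o `|b|) => d d'.
by rewrite ler_norml half andbT lerNl opprB distrC half.
Qed.

(* Minkowski's argument.  Prolong the segment from a point [s0] of [S] through
   [x] to the last point [y] dominated by [S].  Some unit vector [c] of [L]
   supports [S] at [y], and [y] is dominated by the face of [S] exposed by [c],
   so that induction applies in the hyperplane of [L] orthogonal to [c]. *)
Lemma dominated_in_convex S H L x :
  compact S -> closed [set d | d \in L] -> convex_set H -> S `<=` H ->
  (forall s, S s -> s - x \in L) ->
  (forall d, d \in L -> exists2 s, S s & inner d x <= inner d s) -> H x.
Proof.
move=> + + cH; have [n] := ubnP (\dim L).
elim: n => // n IH in S L x *; rewrite ltnS => dimL cS clL SH SL dom.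
have [s0 Ss0 _] := dom 0 (mem0v L).
have [->|xs0] := eqVneq x s0; first exact: SH.
have [v vE] : exists v, v = x - s0 by exists (x - s0).
have xE : x = s0 + v by rewrite vE addrC subrK.
have Lv : v \in L by rewrite vE -memvN opprB; exact: SL.
have v0 : 0 < `|v| by rewrite vE normr_gt0 subr_eq0.
have [h hc hP] := support_function cS (ex_intro _ _ Ss0).
(* Parameters of the dominated points on the ray; [x] has parameter 1, and direction [v] bounds [T]
   above. *)
pose T := [set t : R | forall d, d \in L -> inner d (s0 + t *: v) <= h d].
have T1 : T 1.
  move=> d /dom[s Ss]; rewrite scale1r vE addrC subrK => /le_trans; apply.
  by have [/(_ _ Ss)] := hP d.
have vv : 0 < inner v v by rewrite inner_norm exprn_gt0.
have ubT : ubound T ((h v - inner v s0) / inner v v).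
  by move=> t /(_ v Lv); rewrite ler_pdivlMr// !innerE; lra.
have supT : has_sup T by split; [exists 1|exists ((h v - inner v s0) / inner v v)].
pose t := sup T.
have t1 : 1 <= t by exact: (sup_upper_bound supT).
(* The supremum is attained: a direction with [inner d v > 0] bounds [t] from above, and in any
   other the constraint at 1 persists for [t >= 1]. *)
have Tt : T t.
  move=> d Ld; have := T1 d Ld; rewrite !innerE mul1r => T1d.
  have [dv|dv] := ltP 0 (inner d v); last by nra.
  rewrite addrC -lerBrDr -ler_pdivlMr//; apply: ge_sup; first by exists 1.
  by move=> u /(_ d Ld); rewrite !innerE ler_pdivlMr//; lra.
have [y yE] : exists y, y = s0 + t *: v by exists (s0 + t *: v).
have Ty d : d \in L -> inner d y <= h d by rewrite yE; exact: Tt.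
pose U := [set d : V | d \in L] `&` [set d : V | `|d| = 1].
have U0 : U !=set0.
  exists (`|v|^-1 *: v); split; first exact: memvZ.
  by rewrite /= normrZ normfV normr_id mulVf// gt_eqF.
have cU : compact U.
  apply: (@closed_bounded_compact _ _ _ 1); last by move=> d [_ /= ->].
  apply: closedI => //; apply: (@closed_preimage _ _ (fun d : V => `|d|) [set 1]).
    exact: norm_continuous.
  exact: closed_eq.
have gc : continuous (fun d => h d - inner d y).
  move=> d; apply: cvgB; first exact: hc.
  rewrite innerC; under eq_fun do rewrite innerC.
  exact: inner_continuous.
have [c [Lc /= c1] cmin] := compact_min cU U0 gc.
(* Were the least slack [m] over unit directions positive, [y] could move by [m / |v|] along [v] and
   stay dominated, beyond the supremum. *)
have hcy : h c = inner c y.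
  apply/eqP; rewrite eq_le andbC Ty//= -subr_le0 leNgt; apply/negP => m0.
  set m := h c - inner c y in m0 cmin.
  have : T (t + m / `|v|).
    move=> d Ld; rewrite scalerDl addrA -yE.
    have [->|d0] := eqVneq d 0.
      by have [_ [s _ ->]] := hP 0; rewrite !inner0l.
    have dgt0 : 0 < `|d| by rewrite normr_gt0.
    pose u := `|d|^-1 *: d.
    have dE : d = `|d| *: u by rewrite scalerA divff ?scale1r// gt_eqF.
    have u1 : `|u| = 1 by rewrite normrZ normfV normr_id mulVf// gt_eqF.
    have Lu : u \in L by exact: memvZ.
    have hu : `|d| * h u <= h d.
      have [_ [s Ss ->]] := hP u; have [/(_ _ Ss)] := hP d.
      by rewrite {1}dE innerZl.
    apply: le_trans hu; rewrite {1}dE innerZl ler_wpM2l// innerDr innerZr.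
    have := cmin u (conj Lu u1); rewrite -lerBlDr => mu.
    have : m / `|v| * inner u v <= m / `|v| * `|v|.
      rewrite ler_wpM2l ?divr_ge0 ?(ltW m0)//.
      by rewrite (le_trans (inner_le _ _))// u1 mul1r.
    rewrite divfK ?gt_eqF//; lra.
  move=> /(sup_upper_bound supT); rewrite -/t gerDl leNgt.
  by rewrite divr_gt0.
(* The face of [S] exposed by [c]. *)
pose S' := S `&` [set s | inner c s = inner c y].
have [L' subL' L'E] : exists2 L' : {vspace V}, (L' <= L)%VS &
    forall d, (d \in L') = (d \in L) && (inner c d == 0).
  exists (L :&: lker (linfun (inner c : V -> R^o)))%VS; first exact: capvSl.
  by move=> d; rewrite memv_cap memv_ker lfunE.
have Hy : H y.
  apply: (IH S' L').
  (* The dimension drops because [c] is in [L] but, being a unit vector, not in [L']. *)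
  - apply: leq_trans dimL; rewrite ltn_neqAle dimvS// andbT.
    apply/negP => /eqP dimE; have /eqP LL' : L' == L by rewrite eqEdim subL' dimE/=.
    have : c \in L' by rewrite LL'.
    by rewrite L'E inner_norm c1 expr1n oner_eq0 andbF.
  - apply: compact_closedI => //.
    apply: (@closed_preimage _ _ (inner c) [set inner c y]).
      exact: inner_continuous.
    exact: closed_eq.
  - rewrite (_ : [set d | _] = [set d | d \in L] `&` inner c @^-1` [set 0]).
      apply: closedI => //; apply: closed_preimage; first exact: inner_continuous.
      exact: closed_eq.
    rewrite eqEsubset; split => d /=; rewrite L'E.
      by move=> /andP[-> /eqP].
    by move=> [-> ->]; rewrite eqxx.
  - by move=> s [/SH].
  - move=> s [Ss /= cs]; rewrite L'E innerBr cs subrr eqxx andbT.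
    have -> : s - y = (s - x) + (1 - t) *: v.
      by rewrite yE xE scalerBl scale1r !opprD !addrA subrK.
    by rewrite memvD ?SL// memvZ.
  - move=> d; rewrite L'E => /andP[Ld _]; apply: contrapT => noS'.
    have S'lt s : S' s -> inner d s < inner d y.
      by move=> S's; rewrite ltNge; apply/negP => ds; apply: noS'; exists s.
    (* If the face fails to dominate [y] along [d], this compact set misses it, so [inner c] stays
       below [inner c y] there by a fixed gap. *)
    pose S'' := S `&` [set s | inner d y <= inner d s].
    have S''0 : S'' !=set0.
      have [_ [s Ss hs]] := hP d; exists s; split => //=.
      by rewrite -hs; exact: Ty.
    have cS'' : compact S''.
      apply: compact_closedI => //.
      apply: (@closed_preimage _ _ (inner d) [set r | inner d y <= r]).
        exact: inner_continuous.
      exact: closed_ge.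
    have [s1 [Ss1 /= ds1] s1P] := compact_max cS'' S''0 (@inner_continuous _ _ c).
    have cSy s : S s -> inner c s <= inner c y.
      by move=> Ss; rewrite -hcy; apply (hP c).1.
    have cs1 : inner c s1 < inner c y.
      rewrite lt_neqAle cSy// andbT; apply/negP => /eqP cs1.
      by have := S'lt s1 (conj Ss1 cs1); rewrite ltNge ds1.
    set B := h d - inner d y.
    have B0 : 0 <= B by rewrite subr_ge0; exact: Ty.
    (* In direction [N *: c + d], points of [S''] gain at most [B] over [y] from [d] but lose at
       least [B + 1] from [c]; other points of [S] lose along [d] and gain nothing along [c]. So [y]
       is not dominated in that direction. *)
    pose N := (B + 1) / (inner c y - inner c s1).
    have N0 : 0 < N by rewrite divr_gt0 ?subr_gt0// ltr_wpDl.
    have NE : N * (inner c y - inner c s1) = B + 1.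
      by rewrite /N divfK// subr_eq0 gt_eqF.
    have LNd : N *: c + d \in L by rewrite memvD// memvZ.
    have [_ [s Ss hs]] := hP (N *: c + d).
    have := Ty _ LNd; rewrite hs !innerE => key.
    have := cSy s Ss; have [ds|ds] := lerP (inner d y) (inner d s).
      have := s1P s (conj Ss ds); have := (hP d).1 s Ss.
      rewrite -/B; move: B0 NE; rewrite /B; nra.
    by rewrite -(ler_pM2l N0); move: key ds; lra.
(* Since [t >= 1], [x] lies on the segment from [s0] to [y], both in [H]. *)
have -> : x = t^-1 *: y + (1 - t^-1) *: s0.
  rewrite yE scalerDr scalerA mulVf ?scale1r; last first.
    by rewrite gt_eqF// (lt_le_trans _ t1).
  by rewrite scalerBl scale1r [_ + v]addrC addrACA subrr addr0 addrC.
have t0 : 0 < t by exact: lt_le_trans t1.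
move/convex_setP: cH; apply => //; last exact: SH.
by rewrite invr_ge0 ltW//= invf_le1.
Qed.

(** Being dominated by some compact part of [A] is a convex condition, by taking unions, and
    singletons give it on [A]. *)
Lemma convex_hull_dominated (A : set V) (w : V) : convex_hull A w ->
  exists B, [/\ compact B, B `<=` A &
    forall d, exists2 u, B u & inner d w <= inner d u].
Proof.
move=> Aw; apply: (Aw [set w | exists B, [/\ compact B, B `<=` A &
    forall d, exists2 u, B u & inner d w <= inner d u]]); split; last first.
  move=> a Aa; exists [set a]; split; [exact: compact_set1|by move=> _ ->|].
  by move=> d; exists a.
apply/convex_setP => x y t /andP[t0 t1].
move=> [B [cB BA Bx]] [B' [cB' B'A B'y]]; exists (B `|` B'); split.
- exact: compactU.
- by rewrite subUset.
move=> d; have [u Bu xu] := Bx d; have [u' Bu' yu'] := B'y d.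
have [uu'|u'u] := leP (inner d u) (inner d u').
  by exists u'; [right|rewrite !innerE; nra].
by exists u; [left|rewrite !innerE; nra].
Qed.

End Hulls.

(** * Separation of a point from a closed convex set *)

Section Separation.
Variables (R : realType) (V : euclideanType R).

Lemma closed_convex_separation (A : set V) (x : V) :
  closed A -> convex_set A -> A !=set0 -> ~ A x ->
  exists c : V, exists2 a : R, forall z, A z -> inner c z <= a & a < inner c x.
Proof.
move=> clA /convex_setP cA [z0 Az0] Ax.
have dist_continuous : continuous (fun z : V => `|x - z|).
  move=> z; apply: cvg_norm; apply: cvgB; [exact: cvg_cst|exact: cvg_id].
(* Cutting [A] by a ball gives compactness without changing the nearest point [p] to [x]; the
   separating normal is [x - p]. *)
pose A' := A `&` [set z | `|x - z| <= `|x - z0|].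
have cA' : compact A'.
  apply: (@closed_bounded_compact _ _ _ (`|x| + `|x - z0|)).
    by apply: closedI => //; exact: closed_le_preimage.
  move=> z [_ /= zx]; rewrite -[z](subKr x) (le_trans (ler_normB _ _))//.
  by rewrite lerD2l.
have A'0 : A' !=set0 by exists z0; split=> /=.
have [p [Ap /= px] pmin] := compact_min cA' A'0 dist_continuous.
have pP z : A z -> `|x - p| <= `|x - z|.
  move=> Az; have [zx|/ltW zx] := leP `|x - z| `|x - z0|; first exact: pmin.
  exact: le_trans zx.
exists (x - p), (inner (x - p) p); last first.
  rewrite -subr_gt0 -innerBr inner_norm. rewrite exprn_gt0// normr_gt0 subr_eq0.
  by apply/eqP => xp; apply: Ax; rewrite xp.
move=> z Az; rewrite -subr_le0 -innerBr leNgt; apply/negP => b0.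
set b := inner _ _ in b0; set n := inner (z - p) (z - p).
have n0 : 0 <= n by exact: inner_ge0.
have bn : 0 < b + n by rewrite ltr_wpDr.
have expand (d e : V) (r : R) : inner (d - r *: e) (d - r *: e) =
    inner d d - 2 * r * inner d e + r ^+ 2 * inner e e.
  by rewrite !innerE (innerC e d); ring.
(* This step lies in [(0, 1]] and satisfies [t * n <= b], so moving from [p] towards [z] by [t]
   changes the squared distance by [t * (t * n - 2 * b) < 0]. *)
pose t := b / (b + n).
have t0 : 0 < t by rewrite divr_gt0.
have tE : t * (b + n) = b by rewrite divfK// gt_eqF.
have t1 : t <= 1 by rewrite ler_pdivrMr// mul1r lerDl.
have := pP _ (cA z p t _ Az Ap); rewrite (ltW t0) t1 => /(_ isT).
have -> : x - (t *: z + (1 - t) *: p) = (x - p) - t *: (z - p).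
  rewrite scalerBl scale1r scalerBr !opprD !opprK.
  by rewrite -[RHS]addrA; congr (_ + _); rewrite addrCA.
rewrite -(ler_pXn2r (n := 2))// ?nnegrE// -!inner_norm.
rewrite [leRHS]expand -/b -/n; nra.
Qed.

End Separation.

(** * FTvN systems and preimages under [lambda] *)

Section FTvNTheory.
Variables (R : realType) (V W : euclideanType R) (lambda : V -> W).
Hypothesis hl : FTvN lambda.
Implicit Types (x y c : V) (u w : W) (D : set W).
Let K : set W := range lambda.

(** [FTvN_le] at [(x, x)] gives one inequality. For the other, attainment gives [y] with
    [lambda y = lambda x] and [inner x y = |lambda x| ^+ 2]; then [|y| <= |lambda x|], and
    Cauchy-Schwarz concludes. *)
Lemma FTvN_norm x : `|lambda x| = `|x|.
Proof.
apply/eqP; rewrite eq_le; apply/andP; split; last first.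
  rewrite -(ler_pXn2r (n := 2))// ?nnegrE// -!inner_norm.
  exact: FTvN_le.
have [y yx] := FTvN_attained hl x (u := lambda x) (imageT _ _).
rewrite yx inner_norm => xy.
have yle : `|y| <= `|lambda x|.
  rewrite -(ler_pXn2r (n := 2))// ?nnegrE// -!inner_norm -yx.
  exact: FTvN_le.
have := inner_le x y; rewrite xy expr2.
have [->//|l0] := eqVneq (lambda x) 0; first by rewrite normr0.
have lgt0 : 0 < `|lambda x| by rewrite normr_gt0.
by move=> /le_trans/(_ (ler_wpM2l (normr_ge0 x) yle)); rewrite ler_pM2r.
Qed.

(** [lambda] is 1-Lipschitz: expand both squared distances; the norms agree and [FTvN_le] compares
    the cross terms. *)
Lemma FTvN_continuous : continuous lambda.
Proof.
apply: (@lipschitz_continuous _ _ _ 1) => x y; rewrite mul1r.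
rewrite -(ler_pXn2r (n := 2))// ?nnegrE// -!inner_norm !innerE !inner_norm.
rewrite !FTvN_norm (innerC y x) (innerC (lambda y)).
have := FTvN_le hl x y; lra.
Qed.

Lemma FTvN_scale t x : 0 <= t -> lambda (t *: x) = t *: lambda x.
Proof.
move=> t0; apply/eqP; rewrite -subr_eq0 -normr_eq0 -sqrf_eq0 -inner_norm.
rewrite eq_le inner_ge0 andbT !innerE !inner_norm !FTvN_norm normrZ ger0_norm//.
rewrite (innerC (lambda x)).
have := FTvN_le hl (t *: x) x; rewrite innerZl inner_norm; nra.
Qed.

Lemma polar_coneD (u v : W) : polar_cone K u -> polar_cone K v -> polar_cone K (u + v).
Proof.
move=> Ku Kv z Kz; rewrite innerDl.
by have := Ku z Kz; have := Kv z Kz; lra.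
Qed.

Lemma polar_coneZ t (u : W) : 0 <= t -> polar_cone K u -> polar_cone K (t *: u).
Proof. by move=> t0 Ku z Kz; rewrite innerZl mulr_ge0_le0// Ku. Qed.

(** Attainment turns the pairing of [lambda (x + y)] with [lambda c] into [inner (x + y) c'] where
    [lambda c' = lambda c]; split it and apply [FTvN_le] to each term. *)
Lemma FTvN_sublinear x y : polar_cone K (lambda (x + y) - (lambda x + lambda y)).
Proof.
move=> _ [c _ <-].
have [c' c'c] := FTvN_attained hl (x + y) (u := lambda c) (imageT _ _).
rewrite c'c !innerE => <-.
by have := FTvN_le hl x c'; have := FTvN_le hl y c'; rewrite c'c; lra.
Qed.

Lemma preimage_minkowskiE D x : (lambda @^-1` minkowski_sum D (polar_cone K)) x <->
  exists2 u, D u & polar_cone K (lambda x - u).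
Proof.
split=> [[u Du [k Kk ukx]]|[u Du Kk]].
  by exists u => //; rewrite -ukx [u + k]addrC addrK.
by exists u => //; exists (lambda x - u) => //; rewrite addrC subrK.
Qed.

Lemma preimage_minkowski_convex D :
  convex_set D -> convex_set (lambda @^-1` minkowski_sum D (polar_cone K)).
Proof.
move=> /convex_setP cD; apply/convex_setP => x y t t01.
move=> /preimage_minkowskiE[u Du xu] /preimage_minkowskiE[v Dv yv].
have /andP[t0 t1] := t01.
have s0 : 0 <= 1 - t by rewrite subr_ge0.
apply/preimage_minkowskiE; exists (t *: u + (1 - t) *: v); first exact: cD.
(* The sublinearity defect plus a convex combination of polar vectors. *)
have -> : lambda (t *: x + (1 - t) *: y) - (t *: u + (1 - t) *: v) =
    (lambda (t *: x + (1 - t) *: y) - (lambda (t *: x) + lambda ((1 - t) *: y)))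
    + (t *: (lambda x - u) + (1 - t) *: (lambda y - v)).
  rewrite !FTvN_scale// ![_ *: (lambda _ - _)]scalerBr.
  by rewrite [t *: _ - _ + _]addrACA -opprD [RHS]addrA subrK.
by apply: polar_coneD; [exact: FTvN_sublinear|apply: polar_coneD; exact: polar_coneZ].
Qed.

Lemma preimage_sub_minkowski (C : set W) D : C `&` K `<=` D ->
  lambda @^-1` C `<=` lambda @^-1` minkowski_sum D (polar_cone K).
Proof.
move=> CD x Cx; apply/preimage_minkowskiE; exists (lambda x).
  by apply: CD; split => //; exists x.
by move=> z _; rewrite subrr inner0l.
Qed.

Lemma preimage_compact (B : set W) : compact B -> compact (lambda @^-1` B).
Proof.
move=> cB; have [->|/set0P B0] := eqVneq B set0.
  by rewrite preimage_set0; exact: compact0.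
have [b Bb bP] := compact_max cB B0 (@norm_continuous _ W).
apply: (@closed_bounded_compact _ _ _ `|b|).
  apply: closed_preimage; first exact: FTvN_continuous.
  by apply: compact_closed => //; exact: norm_hausdorff.
by move=> x /bP; rewrite FTvN_norm.
Qed.

Lemma preimage_minkowski_convex_hull (C : set W) :
  lambda @^-1` minkowski_sum (convex_hull (C `&` K)) (polar_cone K) `<=`
  convex_hull (lambda @^-1` C).
Proof.
move=> x /preimage_minkowskiE[w /convex_hull_dominated[B [cB BC Bw]] xw].
(* Domination holds in every direction, so Minkowski's induction starts from the whole space. *)
apply: (@dominated_in_convex _ _ (lambda @^-1` B) _ fullv).
- exact: preimage_compact.
- by rewrite (_ : [set` _] = setT)//; apply/seteqP; split=> // d _; exact: memvf.
- exact: convex_hull_convex.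
- by move=> s /BC[Cs _]; exact: sub_gen_smallest.
- by move=> s _; exact: memvf.
move=> d _; have [u Bu wu] := Bw (lambda d).
have [_ Ku] := BC _ Bu; have [s su ds] := FTvN_attained hl d Ku.
exists s; first by rewrite /= su.
rewrite ds su (le_trans _ wu)// (le_trans (FTvN_le hl _ _))//.
have /xw : K (lambda d) by exists d.
by rewrite innerBl subr_le0 !(innerC _ (lambda d)).
Qed.

Lemma preimage_minkowski_closed_convex_hull (C : set W) :
  (C `&` K) !=set0 ->
  lambda @^-1` minkowski_sum (closed_convex_hull (C `&` K)) (polar_cone K) `<=`
  closed_convex_hull (lambda @^-1` C).
Proof.
move=> [u0 [Cu0 [z _ zE]]] x /preimage_minkowskiE[w Cw xw]; apply: contrapT => nx.
have [|c [a Ca ax]] := closed_convex_separation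
  (@closed_convex_hull_closed _ _ _) (@closed_convex_hull_convex _ _ _) _ nx.
  (* Feasibility of [C] makes the hull nonempty, as separation requires. *)
  by exists z; apply: sub_gen_smallest; rewrite /= zE.
(* This half-space contains [C] within [K], since each such [u] lifts to [s] with
   [inner c s = inner (lambda c) u]; hence it contains the closed convex hull. *)
have : inner (lambda c) w <= a.
  apply: (Cw [set u | inner (lambda c) u <= a]); split.
    split; first exact: inner_le_convex.
    by apply: closed_le_preimage; exact: inner_continuous.
  move=> u [Cu Ku] /=; have [s su cs] := FTvN_attained hl c Ku.
  rewrite -su -cs.
  by apply: Ca; apply: sub_gen_smallest; rewrite /= su.
apply/negP; rewrite -ltNge; apply: lt_le_trans ax _.
apply: (le_trans (FTvN_le hl _ _)).
have /xw : K (lambda c) by exists c.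
by rewrite innerBl subr_le0 !(innerC _ (lambda c)).
Qed.

End FTvNTheory.

(** * Hulls of preimages *)

Theorem theorem3p2 (R : realType) (V W : euclideanType R) (lambda : V -> W)
    (C : set W) (hlambda : FTvN lambda) (hC : C `&` range lambda !=set0) :
  let K : set W := range lambda in
  [/\ convex_hull (lambda @^-1` C) =
        lambda @^-1` minkowski_sum (convex_hull (C `&` K)) (polar_cone K),
      lambda @^-1` minkowski_sum (convex_hull (C `&` K)) (polar_cone K) =
        [set x : V | exists2 u : W,
           convex_hull (C `&` K) u & polar_cone K (lambda x - u)] &
      forall D : set W, convex_set D ->
        convex_hull (C `&` K) `<=` D ->
        D `<=` closed_convex_hull (C `&` K) ->
        closed_convex_hull (lambda @^-1` C) =
          closure (lambda @^-1` minkowski_sum D (polar_cone K)) /\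
        (closed (minkowski_sum D (polar_cone K)) ->
          closed_convex_hull (lambda @^-1` C) =
            lambda @^-1` minkowski_sum D (polar_cone K))].
Proof.
move=> K.
have hull_sub : convex_hull (lambda @^-1` C) `<=`
    lambda @^-1` minkowski_sum (convex_hull (C `&` K)) (polar_cone K).
  apply: smallest_sub.
    exact/preimage_minkowski_convex/convex_hull_convex.
  by apply: preimage_sub_minkowski; exact: sub_gen_smallest.
split.
- apply/seteqP; split=> //; last exact: preimage_minkowski_convex_hull.
- apply/seteqP; split=> x; first by move/preimage_minkowskiE.
  by move=> xu; apply/preimage_minkowskiE.
move=> D cD hD Dh.
have clE : closed_convex_hull (lambda @^-1` C) =
    closure (lambda @^-1` minkowski_sum D (polar_cone K)).
  apply/seteqP; split.
    apply: smallest_sub.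
      split; last exact: closed_closure.
      exact/closure_convex/preimage_minkowski_convex.
    apply: subset_trans (@subset_closure _ _).
    apply: preimage_sub_minkowski.
    exact: subset_trans (@sub_gen_smallest _ _ _) hD.
  (* For the reverse inclusion, [D] is enlarged to the closed convex hull. *)
  rewrite closureE; apply: smallest_sub; first exact: closed_convex_hull_closed.
  apply: subset_trans (preimage_minkowski_closed_convex_hull hlambda hC).
  move=> x /preimage_minkowskiE[u /Dh Du xu].
  by apply/preimage_minkowskiE; exists u.
split=> // clD; rewrite clE; apply/esym/closure_id.
by apply: closed_preimage => //; exact: FTvN_continuous.
Qed.
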